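(* Suppose that $0 \le r < 1$ and $u \in h^1_{\mathbb{R}}$. Then \[ \frac{1}{2\pi}\int_0^{2\pi} |u(re^{i\theta}) - u(0)|\,d\theta \;\le\; \inf_{a\in\mathbb{R}} \|u-a\|_{h^1_{\mathbb{R}}}\cdot \frac{1}{2\pi}\int_0^{2\pi} |P_r(e^{i\theta}) - 1|\,d\theta \;=\; \inf_{a\in\mathbb{R}} \|u-a\|_{h^1_{\mathbb{R}}}\left(2 - \frac{4}{\pi}\arccos(r)\right). \]
   Context: $\mathbb{D}$ is the open unit disc. $h^1_{\mathbb{R}}$ is the space of real-valued harmonic functions $u$ on $\mathbb{D}$ with $\|u\|_{h^1_{\mathbb{R}}} = \sup_{0\le r<1} \frac{1}{2\pi}\int_0^{2\pi} |u(re^{i\theta})|\,d\theta < \infty$. $P_r$ is the Poisson kernel $P_r(e^{it}) = \dfrac{1-r^2}{1-2r\cos t + r^2}$. *)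

(* Defs.v *)
From Stdlib Require Import Reals.
From Coquelicot Require Import Coquelicot.
Open Scope R_scope.

Definition in_disc (z : C) : Prop := Cmod z < 1.

(* The point r * e^(i theta). *)
Definition polar (r theta : R) : C := (r * cos theta, r * sin theta).

Definition dx (u : C -> R) (z : C) : R := Derive (fun x => u (x, Im z)) (Re z).
Definition dy (u : C -> R) (z : C) : R := Derive (fun y => u (Re z, y)) (Im z).

Definition C1_on_disc (u : C -> R) : Prop :=
  forall z : C, in_disc z ->
    ex_derive (fun x => u (x, Im z)) (Re z) /\
    ex_derive (fun y => u (Re z, y)) (Im z) /\
    continuous (dx u) z /\
    continuous (dy u) z.

Definition C2_on_disc (u : C -> R) : Prop :=
  C1_on_disc u /\ C1_on_disc (dx u) /\ C1_on_disc (dy u).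

(* Functions on the disc are total functions on C whose values outside the
   disc are irrelevant: the disc is open, and the means below are taken over
   circles of radius r < 1. *)
Definition harmonic_on_disc (u : C -> R) : Prop :=
  C2_on_disc u /\
  forall z : C, in_disc z -> dx (dx u) z + dy (dy u) z = 0.

Definition circle_mean (f : R -> R) : R := / (2 * PI) * RInt f 0 (2 * PI).

(* The supremum is taken in the extended reals. *)
Definition h1_sup (u : C -> R) : Rbar :=
  Lub_Rbar (fun m : R => exists r : R, 0 <= r < 1 /\
    m = circle_mean (fun theta => Rabs (u (polar r theta)))).

Definition in_h1 (u : C -> R) : Prop :=
  harmonic_on_disc u /\ is_finite (h1_sup u).

(* [real] sends infinities to 0, so this is the norm only on h^1.  If u is in
   h^1, then so is u - a for every real constant a. *)
Definition h1_norm (u : C -> R) : R := real (h1_sup u).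

(* For u in h^1 the set below is nonempty and bounded below by 0, so its
   infimum is finite. *)
Definition h1_dist_to_constants (u : C -> R) : R :=
  real (Glb_Rbar (fun m : R => exists a : R, m = h1_norm (fun z => u z - a))).

(* The Poisson kernel as a function of the angle t: P_r(e^(it)). *)
Definition poisson_kernel (r t : R) : R :=
  (1 - r ^ 2) / (1 - 2 * r * cos t + r ^ 2).

(* Main.v *)
Require Import Defs.
From Stdlib Require Import Reals Lra Psatz.
From Coquelicot Require Import Coquelicot.
Open Scope R_scope.

(** On a circle of radius [k < 1], the Poisson formula gives
    [u (k r e^(i th)) - u 0] as the mean over [s] of
    [(P_r (e^(is)) - 1) (u (k e^(i (th + s))) - a)] for every constant [a], since
    [P_r - 1] has mean zero.  A convolution has L^1 norm at most the product of
    the L^1 norms, so the mean of [|u (k r e^(i th)) - u 0|] is at most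
    [||P_r - 1||_1 ||u - a||], and [k -> 1] is absorbed by replacing [r] with
    [r / k], as [||P_r - 1||_1] is an explicit continuous function of [r].

    The Poisson formula is the mean value property transported by
    [phi z = (z + r) / (1 + r z)].  The mean of [u (k phi (l e^(it)))] over [t] does
    not depend on [l] in [0, 1], because its derivative in [l] is a flux of the
    gradient of [u] through a closed curve, which vanishes as [u] has a
    harmonic conjugate.  At [l = 1] one substitutes [phi (e^(it)) = e^(is)], and
    [dt = P_r (e^(is)) ds]. *)

(** * Differential calculus on the disc in two real variables *)

Definition unit_disc (x y : R) : Prop := x * x + y * y < 1.

Definition continuous2 (f : R -> R -> R) (x y : R) : Prop :=
  continuous (fun p : R * R => f (fst p) (snd p)) (x, y).

(** The partial derivatives are carried as explicit functions so that conjugacy can be read off the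
    arguments: [C1_disc f p q] and [C1_disc g (fun x y => - q x y) p] together are the
    Cauchy-Riemann equations for [f + i g]. *)
Definition C1_disc (f fx fy : R -> R -> R) : Prop :=
  forall x y, unit_disc x y ->
    is_derive (fun s => f s y) x (fx x y) /\
    is_derive (fun s => f x s) y (fy x y) /\
    continuous2 fx x y /\ continuous2 fy x y.

Lemma in_disc_unit_disc (x y : R) : in_disc (x, y) <-> unit_disc x y.
Proof.
unfold in_disc, unit_disc, Cmod; simpl.
replace (x * (x * 1) + y * (y * 1)) with (x * x + y * y) by ring.
split; intro H.
- destruct (Rlt_or_le (x * x + y * y) 1) as [H'|H']; [exact H'|].
  apply sqrt_le_1_alt in H'. rewrite sqrt_1 in H'. lra.
- rewrite <- sqrt_1. apply sqrt_lt_1_alt. nra.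
Qed.

Lemma C1_on_disc_C1_disc (u : C -> R) :
  C1_on_disc u ->
  C1_disc (fun x y => u (x, y)) (fun x y => dx u (x, y)) (fun x y => dy u (x, y)).
Proof.
intros H x y Hxy.
destruct (H (x, y) (proj2 (in_disc_unit_disc x y) Hxy)) as (H1 & H2 & H3 & H4).
split; [|split; [|split]].
- exact (Derive_correct _ _ H1).
- exact (Derive_correct _ _ H2).
- unfold continuous2.
  apply (continuous_ext (dx u)); [intros [a b]; reflexivity|exact H3].
- unfold continuous2.
  apply (continuous_ext (dy u)); [intros [a b]; reflexivity|exact H4].
Qed.

Lemma continuous2_fst (x y : R) : continuous2 (fun a _ => a) x y.
Proof. apply continuous_fst. Qed.

Lemma continuous2_snd (x y : R) : continuous2 (fun _ b => b) x y.
Proof. apply continuous_snd. Qed.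

Lemma continuous2_comp2 (f g h : R -> R -> R) (x y : R) :
  continuous2 f x y -> continuous2 g x y -> continuous2 h (f x y) (g x y) ->
  continuous2 (fun a b => h (f a b) (g a b)) x y.
Proof.
intros Hf Hg Hh. unfold continuous2.
exact (continuous_comp_2 (fun p : R * R => f (fst p) (snd p))
  (fun p : R * R => g (fst p) (snd p)) h (x, y) Hf Hg Hh).
Qed.

Lemma continuous2_continuous (h : R -> R -> R) (f g : R -> R) (x : R) :
  continuous f x -> continuous g x -> continuous2 h (f x) (g x) ->
  continuous (fun s => h (f s) (g s)) x.
Proof. intros Hf Hg Hh. exact (continuous_comp_2 f g h x Hf Hg Hh). Qed.

Lemma unit_disc_open (x y : R) :
  unit_disc x y -> locally (x, y) (fun p => unit_disc (fst p) (snd p)).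
Proof.
intro H.
assert (Hc : continuous (fun p : R * R => fst p * fst p + snd p * snd p) (x, y)).
{ apply (continuous_plus (fun p : R * R => fst p * fst p) (fun p => snd p * snd p)).
  - apply (continuous_mult (K := R_AbsRing) (fun p : R * R => fst p) (fun p => fst p));
      apply continuous_fst.
  - apply (continuous_mult (K := R_AbsRing) (fun p : R * R => snd p) (fun p => snd p));
      apply continuous_snd. }
apply (Hc (fun z => z < 1)). apply (open_lt 1). exact H.
Qed.

(** Total differentiability follows from an x-derivative that exists near the point and is
    continuous at it, together with the y-derivative at the point. *)
Lemma C1_disc_differentiable (f fx fy : R -> R -> R) (x y : R) :
  C1_disc f fx fy -> unit_disc x y ->
  differentiable_pt_lim f x y (fx x y) (fy x y).
Proof.
intros Hf Hxy. apply filterdiff_differentiable_pt_lim.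
destruct (Hf x y Hxy) as (_ & H2 & H3 & _).
apply (is_derive_filterdiff f x y fx (fy x y)); [|exact H2|exact H3].
refine (filter_imp _ _ _ (unit_disc_open x y Hxy)).
intros [a b] Hab. exact (proj1 (Hf a b Hab)).
Qed.

Lemma C1_disc_comp (f fx fy : R -> R -> R) (X Y : R -> R) (t X' Y' : R) :
  C1_disc f fx fy -> unit_disc (X t) (Y t) ->
  is_derive X t X' -> is_derive Y t Y' ->
  is_derive (fun s => f (X s) (Y s)) t (fx (X t) (Y t) * X' + fy (X t) (Y t) * Y').
Proof.
intros Hf Hd HX HY. apply is_derive_Reals. apply derivable_pt_lim_comp_2d.
- exact (C1_disc_differentiable f fx fy _ _ Hf Hd).
- apply is_derive_Reals; exact HX.
- apply is_derive_Reals; exact HY.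
Qed.

Lemma C1_disc_continuous (f fx fy : R -> R -> R) (x y : R) :
  C1_disc f fx fy -> unit_disc x y -> continuous2 f x y.
Proof.
intros Hf Hxy.
apply (filterdiff_continuous (fun p : R * R => f (fst p) (snd p))).
eexists. apply filterdiff_differentiable_pt_lim.
exact (C1_disc_differentiable f fx fy x y Hf Hxy).
Qed.

Lemma continuous2_slice_l (f : R -> R -> R) (x y : R) :
  continuous2 f x y -> continuous (fun s => f s y) x.
Proof.
intro H. apply (continuous2_continuous f (fun s => s) (fun _ => y)).
- apply continuous_id.
- apply continuous_const.
- exact H.
Qed.

Lemma continuous2_slice_r (f : R -> R -> R) (x y : R) :
  continuous2 f x y -> continuous (fun s => f x s) y.
Proof.
intro H. apply (continuous2_continuous f (fun _ => x) (fun s => s)).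
- apply continuous_const.
- apply continuous_id.
- exact H.
Qed.

(** * Parametric integrals, harmonic conjugates and flux through closed curves *)

Lemma is_derive_RInt_parameter (f df : R -> R -> R) (a b x : R) :
  locally x (fun s => forall t, Rmin a b <= t <= Rmax a b ->
    is_derive (fun z => f z t) s (df s t) /\ continuous (fun v => f s v) t) ->
  (forall t, Rmin a b <= t <= Rmax a b ->
    continuous2 df x t /\
    locally (x, t) (fun p => is_derive (fun z => f z (snd p)) (fst p) (df (fst p) (snd p)))) ->
  is_derive (fun s => RInt (fun t => f s t) a b) x (RInt (fun t => df x t) a b).
Proof.
intros H1 H2.
assert (Hx := locally_singleton _ _ H1). simpl in Hx.
rewrite (RInt_ext (fun t => df x t) (fun t => Derive (fun z => f z t) x)).
2:{ intros t Ht. symmetry. apply is_derive_unique. apply Hx. lra. }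
apply is_derive_RInt_param.
- refine (filter_imp _ _ _ H1). intros s Hs t Ht. eexists. apply (Hs t Ht).
(* [is_derive_RInt_param] asks for joint continuity of [Derive]. Near [(x, t)] it agrees with [df],
   so the continuity of [df] transfers. *)
- intros t Ht. destruct (H2 t Ht) as [Hc Hl].
  apply continuity_2d_pt_filterlim.
  rewrite (is_derive_unique _ _ _ (proj1 (Hx t Ht))).
  apply (filterlim_ext_loc (fun p : R * R => df (fst p) (snd p))).
  + refine (filter_imp _ _ _ Hl). intros p Hp. symmetry. apply is_derive_unique. exact Hp.
  + exact Hc.
- refine (filter_imp _ _ _ H1). intros s Hs. apply (ex_RInt_continuous (V := R_CompleteNormedModule)).
  intros t Ht. apply (Hs t Ht).
Qed.

Lemma segment_sq_le (y s : R) : Rmin 0 y <= s <= Rmax 0 y -> s * s <= y * y.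
Proof. unfold Rmin, Rmax. destruct (Rle_dec 0 y); nra. Qed.

Lemma unit_disc_open_l (x y : R) : unit_disc x y -> locally x (fun s => unit_disc s y).
Proof.
intro H. destruct (unit_disc_open x y H) as [e He]. exists e. intros s Hs.
apply (He (s, y)). split; [exact Hs|apply ball_center].
Qed.

Lemma unit_disc_open_r (x y : R) : unit_disc x y -> locally y (fun s => unit_disc x s).
Proof.
intro H. destruct (unit_disc_open x y H) as [e He]. exists e. intros s Hs.
apply (He (x, s)). split; [apply ball_center|exact Hs].
Qed.

(** The integrands of the conjugate are known to be continuous only inside the disc; [D] collects
    endpoints [b] for which the segment from 0 to [b] stays there. *)
Lemma is_derive_RInt_upper (f : R -> R) (y : R) (D : R -> Prop) :
  locally y D ->
  (forall b s, D b -> Rmin 0 b <= s <= Rmax 0 b -> continuous f s) ->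
  is_derive (fun b => RInt f 0 b) y (f y).
Proof.
intros HD Hf. apply (is_derive_RInt f (fun b => RInt f 0 b) 0 y).
- refine (filter_imp _ _ _ HD). intros b Hb.
  apply (RInt_correct f). apply (ex_RInt_continuous (V := R_CompleteNormedModule)).
  intros s Hs. exact (Hf b s Hb Hs).
- apply (Hf y); [exact (locally_singleton _ _ HD)|].
  split; [apply Rmin_r|apply Rmax_r].
Qed.

(** The hypothesis [px + qy = 0] says that the form [- q dx + p dy] is closed. Its primitive is
    obtained by integrating from the origin along the horizontal axis to [(x, 0)], then vertically
    to [(x, y)]; both segments stay in the disc. *)
Lemma conjugate_exists (p px py q qx qy : R -> R -> R) :
  C1_disc p px py -> C1_disc q qx qy ->
  (forall x y, unit_disc x y -> px x y + qy x y = 0) ->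
  exists v, C1_disc v (fun x y => - q x y) p.
Proof.
intros Hp Hq Hpq.
exists (fun x y => RInt (fun s => p x s) 0 y - RInt (fun s => q s 0) 0 x).
assert (Hseg : forall x y s, unit_disc x y -> Rmin 0 y <= s <= Rmax 0 y -> unit_disc x s).
{ intros x y s H Hs. apply segment_sq_le in Hs. unfold unit_disc in *. lra. }
intros x y Hxy.
assert (Hx0 : is_derive (fun b => RInt (fun s => q s 0) 0 b) x (q x 0)).
{ apply (is_derive_RInt_upper (fun s => q s 0) x (fun s => unit_disc s y)).
  - exact (unit_disc_open_l x y Hxy).
  - intros b s Hb Hs. apply segment_sq_le in Hs.
    apply continuous2_slice_l, (C1_disc_continuous q qx qy); [exact Hq|].
    unfold unit_disc in *. nra. }
assert (Hy0 : is_derive (fun b => RInt (fun s => p x s) 0 b) y (p x y)).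
{ apply (is_derive_RInt_upper (fun s => p x s) y (fun s => unit_disc x s)).
  - exact (unit_disc_open_r x y Hxy).
  - intros b s Hb Hs.
    apply continuous2_slice_r, (C1_disc_continuous p px py); [exact Hp|].
    exact (Hseg x b s Hb Hs). }
(* Under the integral sign [px = - qy], which integrates to [q x 0 - q x y]. The term [q x 0]
   cancels against the derivative of the horizontal integral. *)
assert (Hxp : is_derive (fun a => RInt (fun s => p a s) 0 y) x (q x 0 - q x y)).
{ replace (q x 0 - q x y) with (RInt (fun s => px x s) 0 y).
  - apply is_derive_RInt_parameter.
    + refine (filter_imp _ _ _ (unit_disc_open_l x y Hxy)). intros a Ha t Ht.
      specialize (Hseg a y t Ha Ht). split.
      * apply (Hp a t Hseg).
      * apply continuous2_slice_r, (C1_disc_continuous p px py); assumption.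
    + intros t Ht. specialize (Hseg x y t Hxy Ht). split.
      * apply (Hp x t Hseg).
      * refine (filter_imp _ _ _ (unit_disc_open x t Hseg)). intros [a b] Hab.
        apply (Hp a b Hab).
  - rewrite (RInt_ext _ (fun s => opp (qy x s))).
    2:{ intros t Ht. assert (H := Hpq x t (Hseg x y t Hxy ltac:(lra))).
        unfold opp; simpl. lra. }
    apply is_RInt_unique.
    replace (q x 0 - q x y) with (opp (minus (q x y) (q x 0)))
      by (unfold minus, plus, opp; simpl; ring).
    apply (is_RInt_opp (V := R_NormedModule)).
    apply (is_RInt_derive (V := R_CompleteNormedModule) (fun s => q x s)).
    + intros t Ht. apply (Hq x t (Hseg x y t Hxy Ht)).
    + intros t Ht. apply continuous2_slice_r. apply (Hq x t (Hseg x y t Hxy Ht)). }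
split; [|split; [|split]].
- replace (- q x y) with (minus (q x 0 - q x y) (q x 0))
    by (unfold minus, plus, opp; simpl; ring).
  apply (is_derive_minus (K := R_AbsRing) (V := R_NormedModule)); assumption.
- replace (p x y) with (minus (p x y) zero) by (unfold minus, plus, opp, zero; simpl; ring).
  apply (is_derive_minus (K := R_AbsRing) (V := R_NormedModule)); [exact Hy0|].
  apply (is_derive_const (K := R_AbsRing) (V := R_NormedModule)).
- apply (continuous_opp (V := R_NormedModule) (fun z : R * R => q (fst z) (snd z))).
  exact (C1_disc_continuous q qx qy x y Hq Hxy).
- exact (C1_disc_continuous p px py x y Hp Hxy).
Qed.

(* If [X + i Y] is a holomorphic function of [l e^(it)], then [l * d/dl] of the
   mean of [f] is the flux of the gradient of [f] through the closed curve
   [t |-> (X l t, Y l t)], that is, the increment of the conjugate [g] along it. *)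
Lemma RInt_closed_curves_constant (f p q g : R -> R -> R) (X Y A B : R -> R -> R) (L : R) :
  C1_disc f p q -> C1_disc g (fun x y => - q x y) p -> 1 < L ->
  (forall l t, -L < l < L ->
    unit_disc (X l t) (Y l t) /\
    is_derive (fun z => X z t) l (A l t) /\ is_derive (fun z => Y z t) l (B l t) /\
    is_derive (fun z => X l z) t (- l * B l t) /\ is_derive (fun z => Y l z) t (l * A l t) /\
    continuous2 X l t /\ continuous2 Y l t /\ continuous2 A l t /\ continuous2 B l t) ->
  (forall l, X l 0 = X l (2 * PI) /\ Y l 0 = Y l (2 * PI)) ->
  RInt (fun t => f (X 1 t) (Y 1 t)) 0 (2 * PI) = RInt (fun t => f (X 0 t) (Y 0 t)) 0 (2 * PI).
Proof.
intros Hf Hg HL HXY Hper.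
set (F := fun l t => p (X l t) (Y l t) * A l t + q (X l t) (Y l t) * B l t).
assert (HFc : forall l t, -L < l < L -> continuous2 F l t).
{ intros l t Hl. destruct (HXY l t Hl) as (Hd & _ & _ & _ & _ & cX & cY & cA & cB).
  destruct (Hf _ _ Hd) as (_ & _ & cp & cq).
  apply (continuous_plus (V := R_NormedModule)
    (fun z : R * R => p (X (fst z) (snd z)) (Y (fst z) (snd z)) * A (fst z) (snd z))
    (fun z : R * R => q (X (fst z) (snd z)) (Y (fst z) (snd z)) * B (fst z) (snd z))).
  - apply (continuous_mult (K := R_AbsRing)
      (fun z : R * R => p (X (fst z) (snd z)) (Y (fst z) (snd z)))
      (fun z : R * R => A (fst z) (snd z))); [|exact cA].
    exact (continuous2_comp2 X Y p l t cX cY cp).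
  - apply (continuous_mult (K := R_AbsRing)
      (fun z : R * R => q (X (fst z) (snd z)) (Y (fst z) (snd z)))
      (fun z : R * R => B (fst z) (snd z))); [|exact cB].
    exact (continuous2_comp2 X Y q l t cX cY cq). }
assert (HF : forall l t, -L < l < L ->
  is_derive (fun z => f (X z t) (Y z t)) l (F l t)).
{ intros l t Hl. destruct (HXY l t Hl) as (Hd & dX & dY & _).
  exact (C1_disc_comp f p q (fun z => X z t) (fun z => Y z t) l _ _ Hf Hd dX dY). }
assert (HLo : forall l, -L < l < L -> locally l (fun z => -L < z < L)).
{ intros l Hl. apply (open_and _ _ (open_gt (-L)) (open_lt L)). exact Hl. }
assert (Hder : forall l, -L < l < L ->
  is_derive (fun l => RInt (fun t => f (X l t) (Y l t)) 0 (2 * PI)) l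
    (RInt (fun t => F l t) 0 (2 * PI))).
{ intros l Hl. apply (is_derive_RInt_parameter (fun l t => f (X l t) (Y l t)) F).
  - refine (filter_imp _ _ _ (HLo l Hl)). intros s Hs t _. split; [exact (HF s t Hs)|].
    destruct (HXY s t Hs) as (Hd & _ & _ & _ & _ & cX & cY & _).
    apply (continuous2_continuous f (fun z => X s z) (fun z => Y s z)).
    + apply continuous2_slice_r; exact cX.
    + apply continuous2_slice_r; exact cY.
    + exact (C1_disc_continuous f p q _ _ Hf Hd).
  - intros t _. split; [exact (HFc l t Hl)|].
    destruct (HLo l Hl) as [e He]. exists e. intros [s z] [Hs _].
    exact (HF s z (He s Hs)). }
assert (Hflux : forall l, -L < l < L -> l * RInt (fun t => F l t) 0 (2 * PI) = 0).
{ intros l Hl.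
  assert (Hex : ex_RInt (fun t => F l t) 0 (2 * PI)).
  { apply (ex_RInt_continuous (V := R_CompleteNormedModule)). intros t _.
    apply continuous2_slice_r. exact (HFc l t Hl). }
  change (scal l (RInt (fun t => F l t) 0 (2 * PI)) = 0).
  rewrite <- (RInt_scal (V := R_CompleteNormedModule)) by exact Hex.
  apply is_RInt_unique.
  replace 0 with (minus (g (X l (2 * PI)) (Y l (2 * PI))) (g (X l 0) (Y l 0))) at 2.
  2:{ destruct (Hper l) as [-> ->]. unfold minus, plus, opp; simpl; ring. }
  apply (is_RInt_derive (V := R_CompleteNormedModule) (fun t => g (X l t) (Y l t))).
  - intros t _. destruct (HXY l t Hl) as (Hd & _ & _ & dX & dY & _).
    assert (H := C1_disc_comp g _ p (fun z => X l z) (fun z => Y l z) t _ _ Hg Hd dX dY).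
    cbv beta in H.
    refine (eq_ind _ (is_derive (V := R_NormedModule) _ t) H _ _).
    unfold F, scal; simpl; unfold mult; simpl; ring.
  - intros t _. apply (continuous_scal_r (V := R_NormedModule) l (fun t => F l t)).
    apply continuous2_slice_r. exact (HFc l t Hl). }
(* The flux identity determines the derivative only for [l <> 0]. [MVT_gen] asks for it on the open
   interval alone, with continuity at the endpoints; at [l = 1] this continuity comes from
   [1 < L]. *)
destruct (MVT_gen (fun l => RInt (fun t => f (X l t) (Y l t)) 0 (2 * PI)) 0 1 (fun _ => 0))
  as (c & _ & Hc).
- intros l Hl. rewrite Rmin_left, Rmax_right in Hl by lra.
  destruct (Rmult_integral _ _ (Hflux l ltac:(lra))) as [H|H]; [lra|].
  assert (Hd := Hder l ltac:(lra)). rewrite H in Hd. exact Hd.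
- intros l Hl. rewrite Rmin_left, Rmax_right in Hl by lra.
  apply continuity_pt_filterlim.
  apply (ex_derive_continuous (V := R_NormedModule)
    (fun l => RInt (fun t => f (X l t) (Y l t)) 0 (2 * PI))).
  eexists. exact (Hder l ltac:(lra)).
- lra.
Qed.

(** * Rules of joint continuity, and the Möbius map [phi] in polar coordinates *)

Lemma continuous2_const (c x y : R) : continuous2 (fun _ _ => c) x y.
Proof. apply continuous_const. Qed.

Lemma continuous2_plus (f g : R -> R -> R) (x y : R) :
  continuous2 f x y -> continuous2 g x y -> continuous2 (fun a b => f a b + g a b) x y.
Proof.
intros Hf Hg. exact (continuous_plus (V := R_NormedModule)
  (fun p : R * R => f (fst p) (snd p)) (fun p : R * R => g (fst p) (snd p)) (x, y) Hf Hg).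
Qed.

Lemma continuous2_minus (f g : R -> R -> R) (x y : R) :
  continuous2 f x y -> continuous2 g x y -> continuous2 (fun a b => f a b - g a b) x y.
Proof.
intros Hf Hg. exact (continuous_minus (V := R_NormedModule)
  (fun p : R * R => f (fst p) (snd p)) (fun p : R * R => g (fst p) (snd p)) (x, y) Hf Hg).
Qed.

Lemma continuous2_mult (f g : R -> R -> R) (x y : R) :
  continuous2 f x y -> continuous2 g x y -> continuous2 (fun a b => f a b * g a b) x y.
Proof.
intros Hf Hg. exact (continuous_mult (K := R_AbsRing)
  (fun p : R * R => f (fst p) (snd p)) (fun p : R * R => g (fst p) (snd p)) (x, y) Hf Hg).
Qed.

Lemma continuous2_comp (f : R -> R -> R) (h : R -> R) (x y : R) :
  continuous2 f x y -> continuous h (f x y) -> continuous2 (fun a b => h (f a b)) x y.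
Proof.
intros Hf Hh.
exact (continuous_comp (fun p : R * R => f (fst p) (snd p)) h (x, y) Hf Hh).
Qed.

Lemma continuous2_div (f g : R -> R -> R) (x y : R) :
  continuous2 f x y -> continuous2 g x y -> g x y <> 0 ->
  continuous2 (fun a b => f a b / g a b) x y.
Proof.
intros Hf Hg H0. apply continuous2_mult; [exact Hf|].
apply (continuous2_comp g Rinv x y Hg).
apply (ex_derive_continuous (V := R_NormedModule)). auto_derive. exact H0.
Qed.

Lemma continuous2_pow (f : R -> R -> R) (n : nat) (x y : R) :
  continuous2 f x y -> continuous2 (fun a b => f a b ^ n) x y.
Proof.
intro Hf. induction n as [|n IH]; simpl.
- apply continuous2_const.
- apply continuous2_mult; assumption.
Qed.

(** The squared modulus of [1 + R0 z] at [z = l e^(it)]. *)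
Definition mobius_den (R0 l t : R) : R := 1 + 2 * R0 * l * cos t + R0 ^ 2 * l ^ 2.

(* Real and imaginary parts of [(z + R0) / (1 + R0 z)] at [z = l e^(it)]. *)
Definition mobius_re (R0 l t : R) : R :=
  R0 + (1 - R0 ^ 2) * (l * cos t + R0 * l ^ 2) / mobius_den R0 l t.
Definition mobius_im (R0 l t : R) : R :=
  (1 - R0 ^ 2) * (l * sin t) / mobius_den R0 l t.

(* Real and imaginary parts of the derivative of the above in [l]. *)
Definition mobius_dre (R0 l t : R) : R :=
  (1 - R0 ^ 2) * (cos t * (1 + R0 ^ 2 * l ^ 2) + 2 * R0 * l) / mobius_den R0 l t ^ 2.
Definition mobius_dim (R0 l t : R) : R :=
  (1 - R0 ^ 2) * (sin t * (1 - R0 ^ 2 * l ^ 2)) / mobius_den R0 l t ^ 2.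

(** The denominator is affine in [cos t], hence a convex combination of its values [(1 + m)^2] and
    [(1 - m)^2] at [cos t = 1] and [cos t = -1], where [m = R0 * l]. *)
Lemma mobius_den_pos (R0 l t : R) : -1 < R0 * l < 1 -> 0 < mobius_den R0 l t.
Proof.
intros H. unfold mobius_den. assert (Hc := COS_bound t).
replace (1 + 2 * R0 * l * cos t + R0 ^ 2 * l ^ 2)
  with (1 + 2 * (R0 * l) * cos t + (R0 * l) ^ 2) by ring.
set (m := R0 * l) in *. set (c := cos t) in *.
assert (H1 : 0 < (1 - m) ^ 2) by (apply pow_lt; lra).
assert (H2 : 0 < (1 + m) ^ 2) by (apply pow_lt; lra).
replace (1 + 2 * m * c + m ^ 2)
  with ((1 + c) / 2 * (1 + m) ^ 2 + (1 - c) / 2 * (1 - m) ^ 2) by field.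
destruct (Rle_lt_dec c 0); nra.
Qed.

Lemma cos_sq (t : R) : cos t ^ 2 = 1 - sin t ^ 2.
Proof. assert (H := sin2_cos2 t). unfold Rsqr in H. lra. Qed.

Section Mobius.

Variables (R0 l t : R).
Hypothesis Hl : -1 < R0 * l < 1.

Let den_neq0 : mobius_den R0 l t <> 0.
Proof. assert (H := mobius_den_pos R0 l t Hl). lra. Qed.

Lemma is_derive_mobius_re_l : is_derive (fun z => mobius_re R0 z t) l (mobius_dre R0 l t).
Proof.
unfold mobius_re, mobius_dre, mobius_den in *. auto_derive.
- contradict den_neq0. rewrite <- den_neq0. ring.
- field. contradict den_neq0. rewrite <- den_neq0. ring.
Qed.

Lemma is_derive_mobius_im_l : is_derive (fun z => mobius_im R0 z t) l (mobius_dim R0 l t).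
Proof.
unfold mobius_im, mobius_dim, mobius_den in *. auto_derive.
- contradict den_neq0. rewrite <- den_neq0. ring.
- field. contradict den_neq0. rewrite <- den_neq0. ring.
Qed.

(** Cauchy-Riemann equations in polar form: a holomorphic function of [l e^(it)] satisfies
    [d/dt = i l d/dl]. This is the real part, and the next lemma the imaginary part. *)
Lemma is_derive_mobius_re_t :
  is_derive (fun z => mobius_re R0 l z) t (- l * mobius_dim R0 l t).
Proof.
unfold mobius_re, mobius_dim, mobius_den in *. auto_derive.
- contradict den_neq0. rewrite <- den_neq0. ring.
- field. contradict den_neq0. rewrite <- den_neq0. ring.
Qed.

Lemma is_derive_mobius_im_t :
  is_derive (fun z => mobius_im R0 l z) t (l * mobius_dre R0 l t).
Proof.
unfold mobius_im, mobius_dre, mobius_den in *. auto_derive.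
- contradict den_neq0. rewrite <- den_neq0. ring.
- field_simplify_eq; [|contradict den_neq0; rewrite <- den_neq0; ring].
  replace (sin t ^ 2) with (1 - cos t ^ 2) by (rewrite cos_sq; ring).
  ring.
Qed.

Ltac continuous2_auto :=
  cbv beta;
  lazymatch goal with
  | |- continuous2 (fun a b => a) _ _ => apply continuous2_fst
  | |- continuous2 (fun a b => b) _ _ => apply continuous2_snd
  | |- continuous2 (fun a b => cos b) ?x ?y =>
      apply (continuous2_comp (fun _ b => b) cos x y); [apply continuous2_snd|apply continuous_cos]
  | |- continuous2 (fun a b => sin b) ?x ?y =>
      apply (continuous2_comp (fun _ b => b) sin x y); [apply continuous2_snd|apply continuous_sin]
  | |- continuous2 (fun a b => @?f a b + @?g a b) ?x ?y =>
      apply (continuous2_plus f g x y); continuous2_auto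
  | |- continuous2 (fun a b => @?f a b - @?g a b) ?x ?y =>
      apply (continuous2_minus f g x y); continuous2_auto
  | |- continuous2 (fun a b => @?f a b * @?g a b) ?x ?y =>
      apply (continuous2_mult f g x y); continuous2_auto
  | |- continuous2 (fun a b => @?f a b ^ ?n) ?x ?y =>
      apply (continuous2_pow f n x y); continuous2_auto
  | |- continuous2 (fun a b => ?c) ?x ?y => apply (continuous2_const c)
  end.

Lemma continuous2_mobius_den : continuous2 (mobius_den R0) l t.
Proof. unfold mobius_den. continuous2_auto. Qed.

Lemma continuous2_mobius_re : continuous2 (mobius_re R0) l t.
Proof.
apply (continuous2_plus (fun _ _ => R0)); [apply continuous2_const|].
apply (continuous2_div (fun l t => (1 - R0 ^ 2) * (l * cos t + R0 * l ^ 2)));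
  [continuous2_auto|exact continuous2_mobius_den|exact den_neq0].
Qed.

Lemma continuous2_mobius_im : continuous2 (mobius_im R0) l t.
Proof.
apply (continuous2_div (fun l t => (1 - R0 ^ 2) * (l * sin t)));
  [continuous2_auto|exact continuous2_mobius_den|exact den_neq0].
Qed.

Lemma continuous2_mobius_dre : continuous2 (mobius_dre R0) l t.
Proof.
apply (continuous2_div (fun l t => (1 - R0 ^ 2) * (cos t * (1 + R0 ^ 2 * l ^ 2) + 2 * R0 * l))
  (fun l t => mobius_den R0 l t ^ 2)); [continuous2_auto| |exact (pow_nonzero _ 2 den_neq0)].
apply (continuous2_pow (mobius_den R0)). exact continuous2_mobius_den.
Qed.

Lemma continuous2_mobius_dim : continuous2 (mobius_dim R0) l t.
Proof.
apply (continuous2_div (fun l t => (1 - R0 ^ 2) * (sin t * (1 - R0 ^ 2 * l ^ 2)))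
  (fun l t => mobius_den R0 l t ^ 2)); [continuous2_auto| |exact (pow_nonzero _ 2 den_neq0)].
apply (continuous2_pow (mobius_den R0)). exact continuous2_mobius_den.
Qed.

(** The numerator on the right is [|z + R0|^2] at [z = l e^(it)]. *)
Lemma mobius_norm_sq :
  mobius_re R0 l t ^ 2 + mobius_im R0 l t ^ 2
  = (l ^ 2 + 2 * R0 * l * cos t + R0 ^ 2) / mobius_den R0 l t.
Proof.
unfold mobius_re, mobius_im, mobius_den in *.
field_simplify_eq; [|contradict den_neq0; rewrite <- den_neq0; ring].
replace (sin t ^ 2) with (1 - cos t ^ 2) by (rewrite cos_sq; ring). ring.
Qed.

End Mobius.

(** The point is [k e^(i th) phi (l e^(it))] when [c + i s = e^(i th)]. The bound
    [(1 + k R0) / (k + R0)] is the value of [l] at which [k phi (-l)] reaches [-1]. It exceeds 1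
    because [(1 - k) (1 - R0) > 0], which leaves room for two-sided derivatives at [l = 1]. *)
Lemma mobius_rotated_in_disc (k R0 c s l t : R) :
  0 < k < 1 -> 0 <= R0 < 1 -> c ^ 2 + s ^ 2 = 1 ->
  - ((1 + k * R0) / (k + R0)) < l < (1 + k * R0) / (k + R0) ->
  -1 < R0 * l < 1 /\
  unit_disc (k * (c * mobius_re R0 l t - s * mobius_im R0 l t))
            (k * (s * mobius_re R0 l t + c * mobius_im R0 l t)).
Proof.
intros Hk HR Hcs Hl.
assert (HL : (1 + k * R0) / (k + R0) * (k + R0) = 1 + k * R0) by (field; lra).
set (L := (1 + k * R0) / (k + R0)) in *.
assert (Hl1 : l * (k + R0) < 1 + k * R0)
  by (rewrite <- HL; apply Rmult_lt_compat_r; lra).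
assert (Hl2 : - l * (k + R0) < 1 + k * R0)
  by (rewrite <- HL; apply Rmult_lt_compat_r; lra).
clear HL Hl.
assert (Hfac : forall a, a * (k + R0) < 1 + k * R0 -> - a * (k + R0) < 1 + k * R0 ->
  R0 * a < 1 /\ 0 < (1 + R0 * a) ^ 2 - (k * (a + R0)) ^ 2).
{ intros a Ha1 Ha2.
  assert (HR2 : R0 * R0 < 1) by nra. assert (Hk2 : k * k < 1) by nra.
  assert (HkR : k * (R0 * R0) < k) by nra. assert (HRk : (k * k) * R0 <= R0) by nra.
  split.
  - apply (Rmult_lt_reg_r (k + R0)); [lra|].
    assert (R0 * (a * (k + R0)) <= R0 * (1 + k * R0)) by (apply Rmult_le_compat_l; lra). lra.
  - replace (_ - _) with ((1 + R0 * a - k * (a + R0)) * (1 + R0 * a + k * (a + R0))) by ring.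
    apply Rmult_lt_0_compat; [|lra].
    apply (Rmult_lt_reg_r (k + R0)); [lra|]. rewrite Rmult_0_l.
    replace ((1 + R0 * a - k * (a + R0)) * (k + R0))
      with ((1 - k * R0) * (k + R0) - (a * (k + R0)) * (k - R0)) by ring.
    set (w := a * (k + R0)) in *. assert (Ha3 : - w < 1 + k * R0) by (unfold w; lra).
    (* The expression is affine in [w], with slope of the sign of [R0 - k]. Replacing [w] by its
       extreme value leaves [2 k (1 - R0^2)] in the first case and [2 R0 (1 - k^2)] in the
       second. *)
    clearbody w. destruct (Rle_lt_dec k R0) as [H|H].
    + assert (- w * (R0 - k) <= (1 + k * R0) * (R0 - k)) by (apply Rmult_le_compat_r; lra). lra.
    + assert (w * (k - R0) < (1 + k * R0) * (k - R0)) by (apply Rmult_lt_compat_r; lra). lra. }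
destruct (Hfac l Hl1 Hl2) as [HRl1 H1].
destruct (Hfac (- l) Hl2 ltac:(lra)) as [HRl2 H2].
assert (HRl : -1 < R0 * l < 1) by lra.
split; [exact HRl|].
unfold unit_disc.
set (x := mobius_re R0 l t). set (y := mobius_im R0 l t).
replace (_ + _) with (k ^ 2 * ((c ^ 2 + s ^ 2) * (x ^ 2 + y ^ 2))) by ring.
rewrite Hcs, Rmult_1_l. unfold x, y. rewrite (mobius_norm_sq R0 l t HRl).
assert (HD := mobius_den_pos R0 l t HRl).
apply (Rmult_lt_reg_r (mobius_den R0 l t)); [exact HD|].
replace (_ * _ * mobius_den R0 l t) with (k ^ 2 * (l ^ 2 + 2 * R0 * l * cos t + R0 ^ 2))
  by (field; lra).
unfold mobius_den. assert (Hc := COS_bound t). set (z := cos t) in *.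
(* The difference is affine in [z], so it suffices to check [z = 1] and [z = -1]. *)
assert (E : (1 + 2 * R0 * l * z + R0 ^ 2 * l ^ 2) - k ^ 2 * (l ^ 2 + 2 * R0 * l * z + R0 ^ 2)
  = (1 + z) / 2 * ((1 + R0 * l) ^ 2 - (k * (l + R0)) ^ 2)
  + (1 - z) / 2 * ((1 + R0 * - l) ^ 2 - (k * (- l + R0)) ^ 2)) by field.
destruct (Rle_lt_dec z 0); nra.
Qed.

Lemma mobius_2PI (R0 l : R) :
  mobius_re R0 l 0 = mobius_re R0 l (2 * PI) /\ mobius_im R0 l 0 = mobius_im R0 l (2 * PI).
Proof.
unfold mobius_re, mobius_im, mobius_den. rewrite cos_2PI, sin_2PI, cos_0, sin_0.
split; reflexivity.
Qed.

(** As [l] goes from 1 to 0 the curves [k e^(i th) phi (l e^(it))] shrink to the point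
    [k R0 e^(i th)], since [phi 0 = R0], and the mean of [f] does not change on the way. *)
Lemma mobius_mean_value (f p q g : R -> R -> R) (k R0 th : R) :
  C1_disc f p q -> C1_disc g (fun x y => - q x y) p ->
  0 < k < 1 -> 0 <= R0 < 1 ->
  RInt (fun t => f (k * (cos th * mobius_re R0 1 t - sin th * mobius_im R0 1 t))
                   (k * (sin th * mobius_re R0 1 t + cos th * mobius_im R0 1 t))) 0 (2 * PI)
  = 2 * PI * f (k * R0 * cos th) (k * R0 * sin th).
Proof.
intros Hf Hg Hk HR.
assert (Hcs : cos th ^ 2 + sin th ^ 2 = 1) by (rewrite cos_sq; ring).
set (c := cos th) in *. set (s := sin th) in *.
rewrite (RInt_closed_curves_constant f p q g
  (fun l t => k * (c * mobius_re R0 l t - s * mobius_im R0 l t))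
  (fun l t => k * (s * mobius_re R0 l t + c * mobius_im R0 l t))
  (fun l t => k * (c * mobius_dre R0 l t - s * mobius_dim R0 l t))
  (fun l t => k * (s * mobius_dre R0 l t + c * mobius_dim R0 l t))
  ((1 + k * R0) / (k + R0)) Hf Hg).
- rewrite (RInt_ext _ (fun _ => f (k * R0 * c) (k * R0 * s))).
  + rewrite RInt_const. unfold scal; simpl; unfold mult; simpl. ring.
  + intros t _. unfold mobius_re, mobius_im, mobius_den. f_equal; field; lra.
- apply (Rmult_lt_reg_r (k + R0)); [lra|].
  replace ((1 + k * R0) / (k + R0) * (k + R0)) with (1 + k * R0) by (field; lra). nra.
- intros l t Hl.
  destruct (mobius_rotated_in_disc k R0 c s l t Hk HR Hcs Hl) as [HRl Hd].
  assert (D1 := is_derive_mobius_re_l R0 l t HRl). assert (D2 := is_derive_mobius_im_l R0 l t HRl).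
  assert (D3 := is_derive_mobius_re_t R0 l t HRl). assert (D4 := is_derive_mobius_im_t R0 l t HRl).
  assert (C1 := continuous2_mobius_re R0 l t HRl). assert (C2 := continuous2_mobius_im R0 l t HRl).
  assert (C3 := continuous2_mobius_dre R0 l t HRl). assert (C4 := continuous2_mobius_dim R0 l t HRl).
  assert (Hlin : forall (m1 m2 : R -> R) (x d1 d2 a b d : R), is_derive m1 x d1 -> is_derive m2 x d2 ->
    d = k * (a * d1 + b * d2) -> is_derive (fun z => k * (a * m1 z + b * m2 z)) x d).
  { intros m1 m2 x d1 d2 a b d H1 H2 ->.
    apply (is_derive_scal (fun z => a * m1 z + b * m2 z)).
    apply (is_derive_plus (K := R_AbsRing) (V := R_NormedModule)
      (fun z => a * m1 z) (fun z => b * m2 z)); apply is_derive_scal; assumption. }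
  assert (Hext : forall (m1 m2 : R -> R) (a b x d : R),
    is_derive (fun z => k * (a * m1 z + - b * m2 z)) x d ->
    is_derive (fun z => k * (a * m1 z - b * m2 z)) x d).
  { intros m1 m2 a b x d. apply is_derive_ext. intro z. simpl. ring. }
  repeat match goal with |- _ /\ _ => split end.
  + exact Hd.
  + apply Hext. apply (Hlin _ _ _ _ _ _ _ _ D1 D2). ring.
  + apply (Hlin _ _ _ _ _ _ _ _ D1 D2). ring.
  + apply Hext. apply (Hlin _ _ _ _ _ _ _ _ D3 D4). ring.
  + apply (Hlin _ _ _ _ _ _ _ _ D3 D4). ring.
  + apply (continuous2_mult (fun _ _ => k)); [apply continuous2_const|].
    apply continuous2_minus; (apply continuous2_mult; [apply continuous2_const|assumption]).
  + apply (continuous2_mult (fun _ _ => k)); [apply continuous2_const|].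
    apply continuous2_plus; (apply continuous2_mult; [apply continuous2_const|assumption]).
  + apply (continuous2_mult (fun _ _ => k)); [apply continuous2_const|].
    apply continuous2_minus; (apply continuous2_mult; [apply continuous2_const|assumption]).
  + apply (continuous2_mult (fun _ _ => k)); [apply continuous2_const|].
    apply continuous2_plus; (apply continuous2_mult; [apply continuous2_const|assumption]).
- intro l. destruct (mobius_2PI R0 l) as [-> ->]. split; reflexivity.
Qed.

(** * The boundary substitution and the Poisson formula *)

Lemma poisson_den_pos (r t : R) : 0 <= r < 1 -> 0 < 1 - 2 * r * cos t + r ^ 2.
Proof.
intro Hr. assert (Hc := COS_bound t).
assert (0 < (1 - r) ^ 2) by (apply pow_lt; lra). nra.
Qed.

Lemma continuous_poisson_kernel (r t : R) : 0 <= r < 1 -> continuous (poisson_kernel r) t.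
Proof.
intro Hr. assert (HE := poisson_den_pos r t Hr).
apply (ex_derive_continuous (V := R_NormedModule)). unfold poisson_kernel.
auto_derive. contradict HE. rewrite <- HE. apply Rle_not_lt. right. ring.
Qed.

(* Twice the argument of [1 / (1 - r e^(is))]. *)
Definition blaschke_shift (r s : R) : R := 2 * atan (r * sin s / (1 - r * cos s)).

Lemma blaschke_den_pos (r s : R) : 0 <= r < 1 -> 0 < 1 - r * cos s.
Proof. intro Hr. assert (Hc := COS_bound s). nra. Qed.

(** With [z = r e^(is)], [P_r - 1 = 2 Re (z / (1 - z))], which is the derivative in [s] of
    [- 2 Im log (1 - z)]. *)
Lemma is_derive_blaschke_shift (r s : R) :
  0 <= r < 1 -> is_derive (blaschke_shift r) s (poisson_kernel r s - 1).
Proof.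
intro Hr. assert (HE := poisson_den_pos r s Hr). assert (HD := blaschke_den_pos r s Hr).
unfold blaschke_shift, poisson_kernel.
evar_last.
- apply (is_derive_scal (fun z => atan (r * sin z / (1 - r * cos z)))).
  apply (is_derive_comp atan (fun z => r * sin z / (1 - r * cos z))).
  + apply is_derive_atan.
  + auto_derive; [lra|reflexivity].
- unfold scal; simpl; unfold mult; simpl; unfold Rsqr.
  set (c := cos s) in *. assert (Hs : sin s * sin s = 1 - c * c).
  { assert (H := cos_sq s). fold c in H. nra. }
  set (q := sin s) in *.
  replace (1 + r * q / (1 - r * c) * (r * q / (1 - r * c)))
    with ((1 - 2 * r * c + r ^ 2) / (1 - r * c) ^ 2).
  2:{ replace (r * q / (1 - r * c) * (r * q / (1 - r * c)))
        with (r ^ 2 * (q * q) / (1 - r * c) ^ 2) by (field; lra).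
      rewrite Hs. field. lra. }
  field_simplify_eq; [|split; lra].
  replace (q ^ 2) with (1 - c * c) by (rewrite <- Hs; ring). ring.
Qed.

(** Adding twice the argument of [1 / (1 - r e^(is))] to [s] multiplies [e^(is)] by
    [(1 - r e^(-is)) / (1 - r e^(is))]. The result is the Blaschke factor
    [(e^(is) - r) / (1 - r e^(is))], whose real and imaginary parts are given here. *)
Lemma cos_sin_blaschke (r s : R) :
  0 <= r < 1 ->
  cos (s + blaschke_shift r s) = ((1 + r ^ 2) * cos s - 2 * r) / (1 - 2 * r * cos s + r ^ 2) /\
  sin (s + blaschke_shift r s) = (1 - r ^ 2) * sin s / (1 - 2 * r * cos s + r ^ 2).
Proof.
intro Hr. assert (HE := poisson_den_pos r s Hr). assert (HD := blaschke_den_pos r s Hr).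
assert (Hdouble : forall q, cos (2 * atan q) = (1 - q ^ 2) / (1 + q ^ 2) /\
                            sin (2 * atan q) = 2 * q / (1 + q ^ 2)).
{ intro q. rewrite cos_2a, sin_2a, cos_atan, sin_atan.
  assert (H0 : 0 < 1 + Rsqr q) by (assert (H := Rle_0_sqr q); lra).
  assert (H1 := sqrt_sqrt (1 + Rsqr q) ltac:(lra)).
  assert (H2 := sqrt_lt_R0 _ H0).
  set (d := sqrt (1 + Rsqr q)) in *. unfold Rsqr in H1, H0.
  replace (1 + q ^ 2) with (d * d) by (rewrite H1; ring).
  split; field; lra. }
unfold blaschke_shift. destruct (Hdouble (r * sin s / (1 - r * cos s))) as [Hc Hs].
rewrite cos_plus, sin_plus, Hc, Hs.
set (c := cos s) in *. assert (Hq : sin s ^ 2 = 1 - c ^ 2).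
{ unfold c. rewrite cos_sq. ring. }
set (q := sin s) in *.
replace (1 + (r * q / (1 - r * c)) ^ 2)
  with ((1 - 2 * r * c + r ^ 2) / (1 - r * c) ^ 2).
2:{ replace ((r * q / (1 - r * c)) ^ 2) with (r ^ 2 * q ^ 2 / (1 - r * c) ^ 2) by (field; lra).
    rewrite Hq. field. lra. }
replace (1 - (r * q / (1 - r * c)) ^ 2)
  with (1 - r ^ 2 * (1 - c ^ 2) / (1 - r * c) ^ 2)
  by (rewrite <- Hq; field; lra).
split; field_simplify_eq; try (split; lra);
  try replace (q ^ 3) with (q * q ^ 2) by ring; rewrite ?Hq; ring.
Qed.

(** The Blaschke factor [(w - r) / (1 - r w)] is the inverse of [phi]. *)
Lemma mobius_blaschke (r s : R) :
  0 <= r < 1 ->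
  mobius_re r 1 (s + blaschke_shift r s) = cos s /\
  mobius_im r 1 (s + blaschke_shift r s) = sin s.
Proof.
intro Hr. assert (HE := poisson_den_pos r s Hr).
unfold mobius_re, mobius_im, mobius_den.
destruct (cos_sin_blaschke r s Hr) as [-> ->].
set (c := cos s) in *. set (E := 1 - 2 * r * c + r ^ 2) in *.
assert (H1 : 1 - r ^ 2 <> 0) by nra.
replace (1 + 2 * r * 1 * (((1 + r ^ 2) * c - 2 * r) / E) + r ^ 2 * 1 ^ 2)
  with ((1 - r ^ 2) ^ 2 / E) by (unfold E in *; field; lra).
split; unfold E in *; field; lra.
Qed.

Lemma blaschke_shift_0 (r : R) : blaschke_shift r 0 = 0.
Proof.
unfold blaschke_shift. rewrite sin_0. replace (r * 0 / _) with 0 by (unfold Rdiv; ring).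
rewrite atan_0. ring.
Qed.

Lemma blaschke_shift_2PI (r : R) : blaschke_shift r (2 * PI) = 0.
Proof.
unfold blaschke_shift. rewrite sin_2PI. replace (r * 0 / _) with 0 by (unfold Rdiv; ring).
rewrite atan_0. ring.
Qed.

Lemma poisson_formula (f p q g : R -> R -> R) (k r th : R) :
  C1_disc f p q -> C1_disc g (fun x y => - q x y) p ->
  0 < k < 1 -> 0 <= r < 1 ->
  RInt (fun s => poisson_kernel r s * f (k * cos (th + s)) (k * sin (th + s))) 0 (2 * PI)
  = 2 * PI * f (k * r * cos th) (k * r * sin th).
Proof.
intros Hf Hg Hk Hr. rewrite <- (mobius_mean_value f p q g k r th Hf Hg Hk Hr).
set (h := fun t => f (k * (cos th * mobius_re r 1 t - sin th * mobius_im r 1 t))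
                     (k * (sin th * mobius_re r 1 t + cos th * mobius_im r 1 t))).
(* The substitution is [t = s + blaschke_shift r s], with [dt = P_r ds]. The shift vanishes at both
   endpoints, so the interval is preserved. *)
transitivity (RInt h (0 + blaschke_shift r 0) (2 * PI + blaschke_shift r (2 * PI))).
2:{ rewrite blaschke_shift_0, blaschke_shift_2PI, !Rplus_0_r. reflexivity. }
rewrite <- (RInt_comp h (fun s => s + blaschke_shift r s) (poisson_kernel r)).
- apply RInt_ext. intros s _. unfold h, scal; simpl; unfold mult; simpl.
  destruct (mobius_blaschke r s Hr) as [-> ->].
  rewrite cos_plus, sin_plus. reflexivity.
- intros s _. set (t := s + blaschke_shift r s). clearbody t.
  assert (HL : - ((1 + k * r) / (k + r)) < 1 < (1 + k * r) / (k + r)).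
  { assert (H : 1 < (1 + k * r) / (k + r)).
    { apply (Rmult_lt_reg_r (k + r)); [lra|].
      replace ((1 + k * r) / (k + r) * (k + r)) with (1 + k * r) by (field; lra). nra. }
    lra. }
  destruct (mobius_rotated_in_disc k r (cos th) (sin th) 1 t Hk Hr
    ltac:(rewrite cos_sq; ring) HL) as [HRl Hd].
  assert (c1 := continuous2_slice_r _ _ _ (continuous2_mobius_re r 1 t HRl)).
  assert (c2 := continuous2_slice_r _ _ _ (continuous2_mobius_im r 1 t HRl)).
  apply (continuous2_continuous f
    (fun t => k * (cos th * mobius_re r 1 t - sin th * mobius_im r 1 t))
    (fun t => k * (sin th * mobius_re r 1 t + cos th * mobius_im r 1 t))).
  + apply (continuous_scal_r (V := R_NormedModule)).
    apply (continuous_minus (V := R_NormedModule));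
      apply (continuous_scal_r (V := R_NormedModule)); assumption.
  + apply (continuous_scal_r (V := R_NormedModule)).
    apply (continuous_plus (V := R_NormedModule));
      apply (continuous_scal_r (V := R_NormedModule)); assumption.
  + exact (C1_disc_continuous f p q _ _ Hf Hd).
- intros s _. split; [|exact (continuous_poisson_kernel r s Hr)].
  replace (poisson_kernel r s) with (plus 1 (poisson_kernel r s - 1))
    by (unfold plus; simpl; ring).
  apply (is_derive_plus (K := R_AbsRing) (V := R_NormedModule) (fun s => s)).
  + apply (is_derive_id (K := R_AbsRing)).
  + exact (is_derive_blaschke_shift r s Hr).
Qed.

(** * The convolution inequality for periodic functions *)

Lemma periodic_antiderivative_shift (w : R -> R) (T : R) :
  (forall s, continuous w s) -> (forall s, w (T + s) = w s) ->
  forall s, RInt w 0 (T + s) - RInt w 0 s = RInt w 0 T.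
Proof.
intros Hw Hper s.
assert (Hex : forall a b, ex_RInt w a b).
{ intros a b. apply (ex_RInt_continuous (V := R_CompleteNormedModule)). intros z _. apply Hw. }
rewrite <- (RInt_Chasles (V := R_CompleteNormedModule) w 0 T (T + s)) by apply Hex.
replace (RInt w T (T + s)) with (RInt w 0 s).
- unfold plus; simpl. ring.
- replace (RInt w T (T + s)) with (RInt w (1 * 0 + T) (1 * s + T))
    by (f_equal; ring).
  rewrite <- (RInt_comp_lin (V := R_CompleteNormedModule)) by apply Hex.
  apply RInt_ext. intros z _. unfold scal; simpl; unfold mult; simpl.
  rewrite Rmult_1_l, Rmult_1_l, Rplus_comm, Hper. reflexivity.
Qed.

(* The integrals up to [b] of both sides are compared by differentiating in
   [b]; this replaces Fubini's theorem. *)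
Lemma RInt_convolution_le (F K w : R -> R) :
  (forall s, continuous F s) -> (forall s, continuous K s) -> (forall s, continuous w s) ->
  (forall s, w (2 * PI + s) = w s) ->
  (forall b, F b <= RInt (fun s => K s * w (b + s)) 0 (2 * PI)) ->
  RInt F 0 (2 * PI) <= RInt K 0 (2 * PI) * RInt w 0 (2 * PI).
Proof.
intros HF HK Hw Hper HFK.
assert (Hpi := PI_RGT_0).
assert (Hex : forall (h : R -> R) a b, (forall s, continuous h s) -> ex_RInt h a b).
{ intros h a b Hh. apply (ex_RInt_continuous (V := R_CompleteNormedModule)).
  intros z _. apply Hh. }
assert (HI : forall (h : R -> R) x, (forall s, continuous h s) ->
  is_derive (fun b => RInt h 0 b) x (h x)).
{ intros h x Hh. apply (is_derive_RInt_upper h x (fun _ => True)).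
  - apply filter_true.
  - intros b s _ _. apply Hh. }
set (W := fun x => RInt w 0 x).
(* [H b] is the integral of the convolution up to [b] with the order of integration exchanged: the
   inner integral of [w (z + s)] over [z] from 0 to [b] is [W (b + s) - W s]. *)
set (H := fun b => RInt (fun s => K s * (W (b + s) - W s)) 0 (2 * PI)).
assert (HWd : forall x, is_derive W x (w x)) by (intro x; apply HI; exact Hw).
assert (HWc : forall x, continuous W x).
{ intro x. apply (ex_derive_continuous (V := R_NormedModule)). eexists. apply HWd. }
assert (Hshift : forall (h : R -> R) b s, (forall z, continuous h z) ->
  continuous (fun s => h (b + s)) s).
{ intros h b s Hh. apply (continuous_comp (fun s => b + s) h); [|apply Hh].
  apply (continuous_plus (V := R_NormedModule)); [apply continuous_const|apply continuous_id]. }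
assert (Hc : forall b s, continuous (fun s => K s * (W (b + s) - W s)) s).
{ intros b s. apply (continuous_mult (K := R_AbsRing) K); [apply HK|].
  apply (continuous_minus (V := R_NormedModule) (fun s => W (b + s)) W); [|apply HWc].
  apply Hshift. exact HWc. }
assert (HHd : forall b, is_derive H b (RInt (fun s => K s * w (b + s)) 0 (2 * PI))).
{ intro b.
  assert (Hd : forall b s, is_derive (fun z => K s * (W (z + s) - W s)) b (K s * w (b + s))).
  { intros z s. apply (is_derive_scal (fun z => W (z + s) - W s)).
    replace (w (z + s)) with (minus (scal 1 (w (z + s))) zero)
      by (unfold minus, plus, opp, zero, scal; simpl; unfold mult; simpl; ring).
    apply (is_derive_minus (K := R_AbsRing) (V := R_NormedModule)
      (fun z => W (z + s)) (fun _ => W s)).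
    - apply (is_derive_comp (K := R_AbsRing) (V := R_NormedModule) W (fun z => z + s)); [apply HWd|].
      auto_derive; [exact I|ring].
    - apply (is_derive_const (K := R_AbsRing) (V := R_NormedModule)). }
  apply (is_derive_RInt_parameter (fun b s => K s * (W (b + s) - W s)) (fun b s => K s * w (b + s))).
  - apply filter_forall. intros z t _. split; [apply Hd|apply Hc].
  - intros t _. split.
    + apply (continuous2_mult (fun _ s => K s) (fun b s => w (b + s))).
      * apply (continuous2_comp (fun _ s => s) K); [apply continuous2_snd|apply HK].
      * apply (continuous2_comp (fun b s => b + s) w); [|apply Hw].
        apply (continuous2_plus (fun b _ => b) (fun _ s => s));
          [apply continuous2_fst|apply continuous2_snd].
    + apply filter_forall. intros [z s]. apply Hd. }
assert (H0 : H 0 = 0).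
{ unfold H. rewrite (RInt_ext _ (fun _ => 0)).
  - rewrite RInt_const. unfold scal; simpl; unfold mult; simpl. ring.
  - intros s _. rewrite Rplus_0_l. change (K s * (W s - W s) = 0). ring. }
(* By periodicity [W (2 * PI + s) - W s] is the integral of [w] over a full period, for every [s],
   and factors out. *)
assert (H2 : H (2 * PI) = RInt K 0 (2 * PI) * RInt w 0 (2 * PI)).
{ unfold H, W. rewrite (RInt_ext _ (fun s => scal (RInt w 0 (2 * PI)) (K s))).
  - rewrite (RInt_scal (V := R_CompleteNormedModule)) by (apply Hex; exact HK).
    unfold scal; simpl; unfold mult; simpl. ring.
  - intros s _. rewrite (periodic_antiderivative_shift w (2 * PI) Hw Hper s).
    unfold scal; simpl; unfold mult; simpl. ring. }
assert (HD : forall b, is_derive (fun b => RInt F 0 b - H b) b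
  (F b - RInt (fun s => K s * w (b + s)) 0 (2 * PI))).
{ intro b. apply (is_derive_minus (K := R_AbsRing) (V := R_NormedModule)
    (fun b => RInt F 0 b) H); [apply HI; exact HF|apply HHd]. }
(* The difference vanishes at 0 and its derivative is nowhere positive, so it is at most 0 at
   [2 * PI]. *)
destruct (MVT_gen (fun b => RInt F 0 b - H b) 0 (2 * PI)
  (fun b => F b - RInt (fun s => K s * w (b + s)) 0 (2 * PI))) as (c & _ & Heq).
- intros b _. apply HD.
- intros b _. apply continuity_pt_filterlim.
  apply (ex_derive_continuous (V := R_NormedModule) (fun b => RInt F 0 b - H b)).
  eexists. apply HD.
- rewrite H0, H2, RInt_point in Heq. unfold zero in Heq; simpl in Heq.
  assert (Hn := HFK c).
  set (G := RInt (fun s => K s * w (c + s)) 0 (2 * PI)) in *.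
  assert (0 <= (G - F c) * (2 * PI)) by (apply Rmult_le_pos; lra).
  change (W (2 * PI)) with (RInt w 0 (2 * PI)). lra.
Qed.

(** * The oscillation bound on circles inside the disc *)

Lemma continuous_circle (f p q : R -> R -> R) (k s : R) :
  C1_disc f p q -> 0 <= k < 1 -> continuous (fun s => f (k * cos s) (k * sin s)) s.
Proof.
intros Hf Hk. apply (continuous2_continuous f (fun s => k * cos s) (fun s => k * sin s)).
- apply (continuous_scal_r (V := R_NormedModule) k cos). apply continuous_cos.
- apply (continuous_scal_r (V := R_NormedModule) k sin). apply continuous_sin.
- apply (C1_disc_continuous f p q); [exact Hf|].
  unfold unit_disc. assert (H := cos_sq s). nra.
Qed.

Lemma continuous_Rabs_comp (h : R -> R) (x : R) :
  continuous h x -> continuous (fun s => Rabs (h s)) x.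
Proof. intro Hh. apply (continuous_comp h Rabs); [exact Hh|apply continuous_Rabs]. Qed.

Lemma continuous_minus_const (h : R -> R) (a x : R) :
  continuous h x -> continuous (fun s => h s - a) x.
Proof.
intro Hh. apply (continuous_minus (V := R_NormedModule) h (fun _ => a));
  [exact Hh|apply continuous_const].
Qed.

Lemma ex_RInt_continuous_everywhere (h : R -> R) (a b : R) :
  (forall s, continuous h s) -> ex_RInt h a b.
Proof.
intro Hh. apply (ex_RInt_continuous (V := R_CompleteNormedModule)). intros z _. apply Hh.
Qed.

Lemma is_RInt_poisson_minus_1 (r a b : R) :
  0 <= r < 1 ->
  is_RInt (fun s => poisson_kernel r s - 1) a b (blaschke_shift r b - blaschke_shift r a).
Proof.
intro Hr. apply (is_RInt_derive (V := R_CompleteNormedModule) (blaschke_shift r)).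
- intros s _. exact (is_derive_blaschke_shift r s Hr).
- intros s _. apply continuous_minus_const, continuous_poisson_kernel. exact Hr.
Qed.

Lemma RInt_harmonic_oscillation_le (f p q g : R -> R -> R) (k r a : R) :
  C1_disc f p q -> C1_disc g (fun x y => - q x y) p ->
  0 < k < 1 -> 0 <= r < 1 ->
  2 * PI * RInt (fun th => Rabs (f (k * r * cos th) (k * r * sin th) - f 0 0)) 0 (2 * PI)
  <= RInt (fun s => Rabs (poisson_kernel r s - 1)) 0 (2 * PI)
     * RInt (fun s => Rabs (f (k * cos s) (k * sin s) - a)) 0 (2 * PI).
Proof.
intros Hf Hg Hk Hr. assert (Hpi := PI_RGT_0).
set (w := fun s => f (k * cos s) (k * sin s)).
set (v := fun th => f (k * r * cos th) (k * r * sin th) - f 0 0).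
assert (Hw : forall s, continuous w s).
{ intro s. apply (continuous_circle f p q k s Hf). lra. }
assert (Hv : forall s, continuous v s).
{ intro s. apply continuous_minus_const. apply (continuous_circle f p q (k * r) s Hf). nra. }
assert (HP : forall s, continuous (fun s => poisson_kernel r s - 1) s).
{ intro s. apply continuous_minus_const, continuous_poisson_kernel. exact Hr. }
assert (Hwt : forall th s, continuous (fun s => w (th + s)) s).
{ intros th s. apply (continuous_comp (fun s => th + s) w); [|apply Hw].
  apply (continuous_plus (V := R_NormedModule)); [apply continuous_const|apply continuous_id]. }
(* Three integrals are combined: the Poisson formula at [r]; the same formula at radius 0, where the
   kernel is 1 and it becomes the mean value property; and [a] times the integral of [P_r - 1],
   which is 0. *)
assert (Hrep : forall th,
  2 * PI * v th = RInt (fun s => (poisson_kernel r s - 1) * (w (th + s) - a)) 0 (2 * PI)).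
{ intro th.
  assert (E1 := poisson_formula f p q g k r th Hf Hg Hk Hr).
  assert (E0 := poisson_formula f p q g k 0 th Hf Hg Hk ltac:(lra)).
  assert (I1 : is_RInt (fun s => poisson_kernel r s * w (th + s)) 0 (2 * PI)
    (2 * PI * f (k * r * cos th) (k * r * sin th))).
  { rewrite <- E1. apply (RInt_correct (V := R_CompleteNormedModule)).
    apply ex_RInt_continuous_everywhere. intro s.
    apply (continuous_mult (K := R_AbsRing) (poisson_kernel r)).
    - apply continuous_poisson_kernel. exact Hr.
    - apply Hwt. }
  assert (I0 : is_RInt (fun s => w (th + s)) 0 (2 * PI) (2 * PI * f 0 0)).
  { replace (f 0 0) with (f (k * 0 * cos th) (k * 0 * sin th)) by (f_equal; ring).
    rewrite <- E0.
    rewrite (RInt_ext _ (fun s => w (th + s))).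
    - apply (RInt_correct (V := R_CompleteNormedModule)).
      apply ex_RInt_continuous_everywhere. apply Hwt.
    - intros s _. change (poisson_kernel 0 s * w (th + s) = w (th + s)).
      unfold poisson_kernel. field. }
  assert (I2 := is_RInt_scal (V := R_NormedModule) _ _ _ a _
    (is_RInt_poisson_minus_1 r 0 (2 * PI) Hr)).
  symmetry. apply is_RInt_unique.
  assert (I3 := is_RInt_minus (V := R_NormedModule) _ _ _ _ _ _
    (is_RInt_minus (V := R_NormedModule) _ _ _ _ _ _ I1 I0) I2).
  rewrite blaschke_shift_0, blaschke_shift_2PI in I3.
  unfold minus, plus, opp, scal in I3; simpl in I3; unfold mult in I3; simpl in I3.
  replace (2 * PI * v th) with
    (2 * PI * f (k * r * cos th) (k * r * sin th) + - (2 * PI * f 0 0) + - (a * (0 + - 0)))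
    by (unfold v; ring).
  refine (is_RInt_ext _ _ _ _ _ _ I3). intros s _. simpl. ring. }
assert (HvR : 2 * PI * RInt (fun th => Rabs (v th)) 0 (2 * PI)
  = RInt (fun th => 2 * PI * Rabs (v th)) 0 (2 * PI)).
{ symmetry. apply (RInt_scal (V := R_CompleteNormedModule) (fun th => Rabs (v th))).
  apply ex_RInt_continuous_everywhere. intro s. apply continuous_Rabs_comp, Hv. }
change (2 * PI * RInt (fun th => Rabs (v th)) 0 (2 * PI)
  <= RInt (fun s => Rabs (poisson_kernel r s - 1)) 0 (2 * PI)
     * RInt (fun s => Rabs (w s - a)) 0 (2 * PI)).
rewrite HvR.
apply (RInt_convolution_le _ (fun s => Rabs (poisson_kernel r s - 1)) (fun s => Rabs (w s - a))).
- intro s. apply (continuous_scal_r (V := R_NormedModule) (2 * PI) (fun th => Rabs (v th))).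
  apply continuous_Rabs_comp, Hv.
- intro s. apply (continuous_Rabs_comp (fun s => poisson_kernel r s - 1)), HP.
- intro s. apply (continuous_Rabs_comp (fun s => w s - a)), continuous_minus_const, Hw.
- intro s. unfold w. rewrite cos_plus, sin_plus, cos_2PI, sin_2PI.
  do 3 f_equal; ring.
- intro th.
  replace (2 * PI * Rabs (v th)) with (Rabs (2 * PI * v th))
    by (rewrite Rabs_mult, (Rabs_pos_eq (2 * PI)) by lra; reflexivity).
  rewrite Hrep.
  eapply Rle_trans; [apply abs_RInt_le; [lra|]|].
  + apply ex_RInt_continuous_everywhere. intro s.
    apply (continuous_mult (K := R_AbsRing) (fun s => poisson_kernel r s - 1)); [apply HP|].
    apply (continuous_minus_const (fun s => w (th + s))), Hwt.
  + right. apply RInt_ext. intros s _. apply Rabs_mult.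
Qed.

(** * The value of the mean of [|P_r - 1|] *)

Lemma blaschke_shift_acos (r : R) :
  0 <= r < 1 -> blaschke_shift r (acos r) = PI - 2 * acos r.
Proof.
intro Hr. assert (Ht := acos_bound_lt r ltac:(lra)).
assert (Hc := cos_acos r ltac:(lra)).
assert (Ht2 : acos r <= PI / 2).
{ apply Rnot_lt_le. intro H. assert (H1 := cos_lt_0 (acos r) H ltac:(lra)). lra. }
assert (Hs := sin_gt_0 (acos r) ltac:(lra) ltac:(lra)).
assert (Hq := cos_sq (acos r)).
unfold blaschke_shift. rewrite Hc in *. set (t := acos r) in *.
(* Since [r = cos t], the quotient is [cos t * sin t / sin t ^ 2], the cotangent of [t]. *)
replace (r * sin t / (1 - r * r)) with (tan (PI / 2 - t)).
- rewrite atan_tan by lra. field.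
- unfold tan. rewrite sin_shift, cos_shift, Hc.
  replace (1 - r * r) with (sin t ^ 2) by lra. field. lra.
Qed.

Lemma blaschke_shift_reflect (r t : R) : blaschke_shift r (2 * PI - t) = - blaschke_shift r t.
Proof.
unfold blaschke_shift. rewrite sin_minus, cos_minus, cos_2PI, sin_2PI.
replace (r * (0 * cos t - 1 * sin t) / (1 - r * (1 * cos t + 0 * sin t)))
  with (- (r * sin t / (1 - r * cos t))).
- rewrite atan_opp. ring.
- unfold Rdiv. replace (1 - r * (1 * cos t + 0 * sin t)) with (1 - r * cos t) by ring. ring.
Qed.

Lemma poisson_minus_1 (r t : R) :
  0 <= r < 1 ->
  poisson_kernel r t - 1 = 2 * r * (cos t - r) / (1 - 2 * r * cos t + r ^ 2).
Proof.
intro Hr. assert (HE := poisson_den_pos r t Hr). unfold poisson_kernel. field. lra.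
Qed.

Lemma poisson_ge_1 (r t : R) : 0 <= r < 1 -> r <= cos t -> 0 <= poisson_kernel r t - 1.
Proof.
intros Hr Ht. rewrite (poisson_minus_1 r t Hr).
apply Rdiv_le_0_compat; [|exact (poisson_den_pos r t Hr)].
apply Rmult_le_pos; lra.
Qed.

Lemma poisson_le_1 (r t : R) : 0 <= r < 1 -> cos t <= r -> poisson_kernel r t - 1 <= 0.
Proof.
intros Hr Ht. rewrite (poisson_minus_1 r t Hr).
assert (0 <= 2 * r * (r - cos t) / (1 - 2 * r * cos t + r ^ 2)).
{ apply Rdiv_le_0_compat; [|exact (poisson_den_pos r t Hr)]. apply Rmult_le_pos; lra. }
replace (2 * r * (cos t - r) / (1 - 2 * r * cos t + r ^ 2))
  with (- (2 * r * (r - cos t) / (1 - 2 * r * cos t + r ^ 2))) by (unfold Rdiv; ring).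
lra.
Qed.

(* [blaschke_shift r] is an antiderivative of [P_r - 1], which changes sign
   exactly at [acos r] and [2 PI - acos r]. *)
Lemma circle_mean_poisson_minus_1 (r : R) :
  0 <= r < 1 ->
  circle_mean (fun t => Rabs (poisson_kernel r t - 1)) = 2 - 4 / PI * acos r.
Proof.
intro Hr. assert (Hpi := PI_RGT_0).
assert (Ht := acos_bound_lt r ltac:(lra)). assert (Hc := cos_acos r ltac:(lra)).
assert (HS := blaschke_shift_acos r Hr).
set (t := acos r) in *.
assert (Hcos2 : forall s, cos s = cos (2 * PI - s)).
{ intro s. rewrite cos_minus, cos_2PI, sin_2PI. ring. }
assert (I1 : is_RInt (fun s => Rabs (poisson_kernel r s - 1)) 0 t
  (blaschke_shift r t - blaschke_shift r 0)).
{ refine (is_RInt_ext _ _ _ _ _ _ (is_RInt_poisson_minus_1 r 0 t Hr)).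
  intros s Hs. rewrite Rmin_left, Rmax_right in Hs by lra.
  symmetry. apply Rabs_pos_eq, poisson_ge_1; [exact Hr|].
  rewrite <- Hc. apply cos_decr_1; lra. }
assert (I2 : is_RInt (fun s => Rabs (poisson_kernel r s - 1)) t (2 * PI - t)
  (- (blaschke_shift r (2 * PI - t) - blaschke_shift r t))).
{ refine (is_RInt_ext _ _ _ _ _ _ (is_RInt_opp (V := R_NormedModule) _ _ _ _
    (is_RInt_poisson_minus_1 r t (2 * PI - t) Hr))).
  intros s Hs. rewrite Rmin_left, Rmax_right in Hs by lra.
  symmetry. apply Rabs_left1, poisson_le_1; [exact Hr|].
  rewrite <- Hc. destruct (Rle_lt_dec s PI) as [H|H].
  - apply cos_decr_1; lra.
  - rewrite (Hcos2 s). apply cos_decr_1; lra. }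
assert (I3 : is_RInt (fun s => Rabs (poisson_kernel r s - 1)) (2 * PI - t) (2 * PI)
  (blaschke_shift r (2 * PI) - blaschke_shift r (2 * PI - t))).
{ refine (is_RInt_ext _ _ _ _ _ _ (is_RInt_poisson_minus_1 r (2 * PI - t) (2 * PI) Hr)).
  intros s Hs. rewrite Rmin_left, Rmax_right in Hs by lra.
  symmetry. apply Rabs_pos_eq, poisson_ge_1; [exact Hr|].
  rewrite <- Hc, (Hcos2 s). apply cos_decr_1; lra. }
assert (I := is_RInt_Chasles (V := R_NormedModule) _ _ _ _ _ _
  (is_RInt_Chasles (V := R_NormedModule) _ _ _ _ _ _ I1 I2) I3).
unfold circle_mean. rewrite (is_RInt_unique _ _ _ _ I).
(* With [S = blaschke_shift r t = PI - 2 * t], the three integrals are [S], [2 S] and [S]; the mean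
   is [4 S / (2 PI)]. *)
rewrite blaschke_shift_0, blaschke_shift_2PI, blaschke_shift_reflect, HS.
unfold plus; simpl. field. lra.
Qed.

(** * Passage to the norm, to the infimum over constants and to the limit of radii *)

Lemma circle_mean_ge_0 (h : R -> R) :
  (forall s, continuous h s) -> (forall s, 0 <= h s) -> 0 <= circle_mean h.
Proof.
intros Hh Hp. assert (Hpi := PI_RGT_0). unfold circle_mean.
apply Rmult_le_pos; [left; apply Rinv_0_lt_compat; lra|].
apply RInt_ge_0; [lra|apply ex_RInt_continuous_everywhere, Hh|]. intros s _. apply Hp.
Qed.

Lemma harmonic_continuous_circle (u : C -> R) (k t : R) :
  harmonic_on_disc u -> 0 <= k < 1 -> continuous (fun s => u (polar k s)) t.
Proof.
intros [[Hu _] _] Hk.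
exact (continuous_circle _ _ _ k t (C1_on_disc_C1_disc u Hu) Hk).
Qed.

Lemma is_finite_Lub_of_bound (E : R -> Prop) (x M : R) :
  E x -> (forall y, E y -> y <= M) -> is_finite (Lub_Rbar E).
Proof.
intros Hx HM. destruct (Lub_Rbar_correct E) as [Hub Hl].
assert (H1 := Hub x Hx). assert (H2 := Hl (Finite M) (fun y Hy => HM y Hy)).
destruct (Lub_Rbar E); try reflexivity; contradiction.
Qed.

Lemma le_real_Lub (E : R -> Prop) (x : R) :
  is_finite (Lub_Rbar E) -> E x -> x <= real (Lub_Rbar E).
Proof.
intros Hf Hx. destruct (Lub_Rbar_correct E) as [Hub _].
assert (H := Hub x Hx). rewrite <- Hf in H. exact H.
Qed.

(** A member of [E] excludes [p_infty] and a lower bound excludes [m_infty], so [real] does not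
    return its default 0. *)
Lemma le_real_Glb (E : R -> Prop) (x m : R) :
  E x -> (forall y, E y -> m <= y) -> m <= real (Glb_Rbar E).
Proof.
intros Hx Hm. destruct (Glb_Rbar_correct E) as [Hlb Hg].
assert (H1 := Hlb x Hx). assert (H2 := Hg (Finite m) (fun y Hy => Hm y Hy)).
destruct (Glb_Rbar E); try contradiction. exact H2.
Qed.

(** By the triangle inequality all circle means of [|u - a|] are at most [h1_norm u + Rabs a]. Their
    supremum is therefore finite, and [h1_norm] of [u - a] is that supremum rather than the default
    0. *)
Lemma circle_mean_le_h1_norm (u : C -> R) (a k : R) :
  in_h1 u -> 0 <= k < 1 ->
  circle_mean (fun s => Rabs (u (polar k s) - a)) <= h1_norm (fun z => u z - a).
Proof.
intros [Hu Hfin] Hk. assert (Hpi := PI_RGT_0).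
apply le_real_Lub; [|exists k; split; [exact Hk|reflexivity]].
apply (is_finite_Lub_of_bound _ (circle_mean (fun s => Rabs (u (polar k s) - a)))
  (h1_norm u + Rabs a)).
- exists k. split; [exact Hk|reflexivity].
- intros y (r & Hr & ->).
  assert (H : circle_mean (fun s => Rabs (u (polar r s))) <= h1_norm u).
  { apply le_real_Lub; [exact Hfin|]. exists r. split; [exact Hr|reflexivity]. }
  assert (Hc : forall s, continuous (fun s => u (polar r s)) s).
  { intro s. apply harmonic_continuous_circle; assumption. }
  assert (Hc1 : forall s, continuous (fun s => Rabs (u (polar r s))) s).
  { intro s. apply (continuous_Rabs_comp (fun s => u (polar r s))), Hc. }
  apply Rle_trans with (circle_mean (fun s => Rabs (u (polar r s))) + Rabs a); [|lra].
  unfold circle_mean.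
  assert (I : is_RInt (fun s => Rabs (u (polar r s)) + Rabs a) 0 (2 * PI)
    (RInt (fun s => Rabs (u (polar r s))) 0 (2 * PI) + (2 * PI - 0) * Rabs a)).
  { apply (is_RInt_plus (V := R_NormedModule)).
    - apply (RInt_correct (V := R_CompleteNormedModule)).
      apply ex_RInt_continuous_everywhere. exact Hc1.
    - apply (is_RInt_const (V := R_NormedModule)). }
  apply Rle_trans with (/ (2 * PI) *
    (RInt (fun s => Rabs (u (polar r s))) 0 (2 * PI) + (2 * PI - 0) * Rabs a)).
  2:{ right. field. lra. }
  apply Rmult_le_compat_l; [left; apply Rinv_0_lt_compat; lra|].
  rewrite <- (is_RInt_unique _ _ _ _ I).
  apply RInt_le; [lra| |eexists; exact I|].
  + apply ex_RInt_continuous_everywhere. intro s.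
    apply (continuous_Rabs_comp (fun s => u (polar r s) - a)).
    apply (continuous_minus_const (fun s => u (polar r s))), Hc.
  + intros s _. unfold Rminus. rewrite <- (Rabs_Ropp a). apply Rabs_triang.
Qed.

Lemma oscillation_le_dilated (u : C -> R) (k r : R) :
  in_h1 u -> 0 < k < 1 -> 0 <= r < 1 ->
  circle_mean (fun th => Rabs (u (polar (k * r) th) - u (RtoC 0)))
    <= h1_dist_to_constants u * (2 - 4 / PI * acos r).
Proof.
intros Hh Hk Hr. assert (Hpi := PI_RGT_0).
destruct (Hh) as [[(Hu & Hux & Huy) Hlap] _].
assert (Hf := C1_on_disc_C1_disc u Hu).
(* Here [p] and [q] are the partial derivatives of [u], and [px + qy = 0] is Laplace's equation. *)
destruct (conjugate_exists _ _ _ _ _ _ (C1_on_disc_C1_disc _ Hux) (C1_on_disc_C1_disc _ Huy)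
  (fun x y H => Hlap (x, y) (proj2 (in_disc_unit_disc x y) H))) as [g Hg].
set (osc := circle_mean (fun th => Rabs (u (polar (k * r) th) - u (RtoC 0)))).
rewrite <- (circle_mean_poisson_minus_1 r Hr).
set (N := circle_mean (fun t => Rabs (poisson_kernel r t - 1))).
assert (HN : 0 <= N).
{ apply circle_mean_ge_0.
  - intro s. apply (continuous_Rabs_comp (fun s => poisson_kernel r s - 1)).
    apply continuous_minus_const, continuous_poisson_kernel. exact Hr.
  - intro s. apply Rabs_pos. }
assert (Hosc : forall a, osc <= N * h1_norm (fun z => u z - a)).
{ intro a. assert (H := RInt_harmonic_oscillation_le _ _ _ g k r a Hf Hg Hk Hr).
  apply Rle_trans with (N * circle_mean (fun s => Rabs (u (polar k s) - a))).
  2:{ apply Rmult_le_compat_l; [exact HN|]. apply circle_mean_le_h1_norm; [exact Hh|lra]. }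
  unfold osc, N, circle_mean.
  apply (Rmult_le_reg_l (2 * PI * (2 * PI))); [nra|].
  match goal with |- 2 * PI * (2 * PI) * (/ (2 * PI) * ?A) <= 2 * PI * (2 * PI) *
      (/ (2 * PI) * ?B * (/ (2 * PI) * ?D)) =>
    replace (2 * PI * (2 * PI) * (/ (2 * PI) * A)) with (2 * PI * A) by (field; lra);
    replace (2 * PI * (2 * PI) * (/ (2 * PI) * B * (/ (2 * PI) * D))) with (B * D) by (field; lra)
  end.
  exact H. }
assert (Hnorm : forall a, 0 <= h1_norm (fun z => u z - a)).
{ intro a. eapply Rle_trans; [|apply (circle_mean_le_h1_norm u a 0 Hh); lra].
  apply circle_mean_ge_0; [|intro s; apply Rabs_pos].
  intro s. apply (continuous_Rabs_comp (fun s => u (polar 0 s) - a)).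
  apply (continuous_minus_const (fun s => u (polar 0 s))).
  apply harmonic_continuous_circle; [exact (proj1 Hh)|lra]. }
rewrite Rmult_comm.
(* If [N > 0], then [osc / N] is a lower bound of the norms and hence of their infimum. If [N = 0],
   as happens for [r = 0], the bound for a single [a] already gives [osc <= 0]. *)
destruct (Rle_lt_or_eq_dec 0 N HN) as [HN0|HN0].
- apply (Rmult_le_reg_l (/ N)); [apply Rinv_0_lt_compat; exact HN0|].
  rewrite <- Rmult_assoc, Rinv_l, Rmult_1_l by lra.
  apply (le_real_Glb _ (h1_norm (fun z => u z - 0))); [exists 0; reflexivity|].
  intros y (a & ->). apply (Rmult_le_reg_l N); [exact HN0|].
  rewrite <- Rmult_assoc, Rinv_r, Rmult_1_l by lra. apply Hosc.
- assert (H := Hosc 0). rewrite <- HN0, Rmult_0_l in *. exact H.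
Qed.

(* Apply the bound on the circles of radius [r / x] for [x] slightly larger
   than [r], and let [x] decrease to [r]. *)
Lemma oscillation_le (u : C -> R) (r : R) :
  in_h1 u -> 0 <= r < 1 ->
  circle_mean (fun th => Rabs (u (polar r th) - u (RtoC 0)))
    <= h1_dist_to_constants u * (2 - 4 / PI * acos r).
Proof.
intros Hh Hr.
destruct (Rle_lt_or_eq_dec 0 r (proj1 Hr)) as [Hr0|<-].
(* For [r = 0] the factor [r / x] would not be positive; every [k] in (0, 1), here 1/2, gives the
   circle of radius 0. *)
2:{ assert (H := oscillation_le_dilated u (1 / 2) 0 Hh ltac:(lra) ltac:(lra)).
    rewrite Rmult_0_r in H. exact H. }
set (osc := circle_mean (fun th => Rabs (u (polar r th) - u (RtoC 0)))).
set (d := h1_dist_to_constants u).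
assert (Hx : forall x, r < x < 1 -> osc <= d * (2 - 4 / PI * acos x)).
{ intros x Hx. assert (Hk : 0 < r / x < 1).
  { split; [apply Rdiv_lt_0_compat; lra|]. apply (Rmult_lt_reg_r x); [lra|].
    replace (r / x * x) with r by (field; lra). lra. }
  assert (H := oscillation_le_dilated u (r / x) x Hh Hk ltac:(lra)).
  replace (r / x * x) with r in H by (field; lra). exact H. }
(* If the bound failed at [r], continuity of [acos] at [r] would make it fail at some [x] slightly
   larger than [r], against [Hx]. *)
destruct (Rle_lt_dec osc (d * (2 - 4 / PI * acos r))) as [H|H]; [exact H|exfalso].
assert (Hc : continuous (fun x => d * (2 - 4 / PI * acos x)) r).
{ apply (continuous_scal_r (V := R_NormedModule) d (fun x => 2 - 4 / PI * acos x)).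
  apply (continuous_minus (V := R_NormedModule) (fun _ => 2) (fun x => 4 / PI * acos x));
    [apply continuous_const|].
  apply (continuous_scal_r (V := R_NormedModule) (4 / PI) acos).
  apply continuity_pt_filterlim, derivable_continuous_pt, derivable_pt_acos. lra. }
destruct (Hc (fun y => y < osc) (open_lt osc _ H)) as [e He].
(* The increment is less than [e], the radius given by continuity, and keeps [x] below 1. *)
set (x := r + Rmin (e / 2) ((1 - r) / 2)).
assert (He0 := cond_pos e).
assert (Hm : 0 < Rmin (e / 2) ((1 - r) / 2)) by (apply Rmin_pos; lra).
assert (Hm1 := Rmin_l (e / 2) ((1 - r) / 2)). assert (Hm2 := Rmin_r (e / 2) ((1 - r) / 2)).
assert (Hlt : d * (2 - 4 / PI * acos x) < osc).
{ apply He. unfold ball; simpl; unfold AbsRing_ball, abs, minus, plus, opp; simpl.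
  unfold x. rewrite Rabs_pos_eq; lra. }
assert (Hge := Hx x ltac:(unfold x; lra)). lra.
Qed.

Theorem theorem4p7 :
  forall (r : R) (u : C -> R),
    0 <= r < 1 -> in_h1 u ->
    circle_mean (fun theta => Rabs (u (polar r theta) - u (RtoC 0)))
      <= h1_dist_to_constants u
         * circle_mean (fun theta => Rabs (poisson_kernel r theta - 1)) /\
    h1_dist_to_constants u
      * circle_mean (fun theta => Rabs (poisson_kernel r theta - 1))
      = h1_dist_to_constants u * (2 - 4 / PI * acos r).
Proof.
intros r u Hr Hu. rewrite (circle_mean_poisson_minus_1 r Hr).
split; [exact (oscillation_le u r Hu Hr)|reflexivity].
Qed.
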